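(* Consider the scalar model $x=y+w$ with $w\sim\mathcal{N}(0,1)$ independent of $y$, and the prior $y\sim\mathcal{N}(0,\rho)$, where $\rho>0$ is an SNR parameter. A linear estimator $\hat y = a\,x$ is learned from $N$ i.i.d. training samples $y_1,\dots,y_N$ drawn from this prior, with full knowledge of the measurement model (infinitely many measurements per sample, $M\to\infty$). The linear bias constrained estimator with hyperparameter $\lambda\geq 0$, denoted $\mathrm{LBCE}(\lambda)$, uses the coefficient $$a_{\mathrm{LBCE}}(\lambda)=\frac{\overline{y^2}}{\overline{y^2}+\frac{1}{\lambda+1}},\qquad \overline{y^2}=\frac{1}{N}\sum_{i=1}^N y_i^2 .$$ Let $\mathrm{BMSE}_N$ denote the Bayesian mean squared error $\mathrm{E}\left[(a_{\mathrm{LBCE}}(\lambda)\,x-y)^2\right]$, where the expectation is over $y\sim\mathcal{N}(0,\rho)$, over $w$, and also over the random sampling of the training set $y_1,\dots,y_N$. Then, for a large enough $\rho$, there exists $\lambda^*>0$ such that $\mathrm{LBCE}(\lambda^* )$ yields a smaller $\mathrm{BMSE}_N$ than that of $\mathrm{LBCE}(\lambda=0)$.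
   Context: Semi data-driven setting: the likelihood $p(x|y)$ is known exactly, $y$ is random but its prior is only partially known through a finite dataset of $N$ samples. $\mathrm{LBCE}(\lambda=0)$ coincides with the linear MMSE estimator fitted to the empirical prior. The bias constrained objective is the empirical mean squared error plus $\lambda$ times the empirical squared bias. *)

(* Defs.v *)
From HB Require Import structures.
From mathcomp Require Import all_boot all_order all_algebra.
From mathcomp Require Import all_classical all_reals all_analysis.
Set Implicit Arguments. Unset Strict Implicit. Unset Printing Implicit Defensive.
Import Order.TTheory GRing.Theory Num.Theory.
Local Open Scope classical_set_scope.
Local Open Scope ring_scope.

Section Defs.
Variable R : realType.

(* E[g(Z)] for Z ~ N(0, v) (v = variance; normal_pdf takes the std dev) *)
Definition gaussE (v : R) (g : R -> R) : R :=
  Rintegral lebesgue_measure setT (fun x => normal_pdf 0 (Num.sqrt v) x * g x).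

(* E[F(y_1,...,y_n)] for y_1,...,y_n i.i.d. N(0, v), as an iterated integral *)
Fixpoint iidE (n : nat) (v : R) (F : seq R -> R) : R :=
  match n with
  | 0 => F [::]
  | n'.+1 => gaussE v (fun y => iidE n' v (fun ys => F (y :: ys)))
  end.

Definition mean_sq (ys : seq R) : R :=
  (\sum_(y <- ys) y ^+ 2) / (size ys)%:R.

Definition a_LBCE (lam : R) (ys : seq R) : R :=
  mean_sq ys / (mean_sq ys + (lam + 1)^-1).

Definition test_mse (rho a : R) : R :=
  gaussE rho (fun y => gaussE 1 (fun w => (a * (y + w) - y) ^+ 2)).

Definition BMSE (N : nat) (rho lam : R) : R :=
  iidE N rho (fun ys => test_mse rho (a_LBCE lam ys)).

End Defs.

(* Main.v *)
(** With [t = 1 / (lam + 1)] and [s] the empirical second moment, the conditional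
    test error is [(t^2 rho + s^2) / (s + t)^2], whose [t]-derivative at [t = 1]
    is [2 s (rho - s) / (s + 1)^3].  It suffices that this has positive mean, a
    first-order expansion with explicit remainder then giving some [t < 1].
    As [E s = rho], one may subtract [g rho * (rho - s)] where
    [g s = s / (s + 1)^3]; since [g] is decreasing except close to [0], what
    remains is nonnegative unless [s < rho^-2].  After multiplication by [rho],
    the gain on the event [s / rho \in [1/8, 5/8]] is bounded below uniformly in
    [rho], whereas the loss on [s < rho^-2] vanishes as [rho] grows.

    All functions of the sum of squares that are integrated are Lipschitz on
    the nonnegative half-line; integrating out one Gaussian variable preserves
    this class, so that each stage of the iterated integral is measurable and
    integrable. *)

Require Import Defs.
From HB Require Import structures.
From mathcomp Require Import all_boot all_order all_algebra.
From mathcomp Require Import all_classical all_reals all_analysis.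
From mathcomp Require Import measurable_realfun ring lra.
Import Order.TTheory GRing.Theory Num.Theory.
Import numFieldNormedType.Exports.
Local Open Scope classical_set_scope.
Local Open Scope ring_scope.

(** * Gaussian expectation under quadratic growth, and the first two moments *)

Section gaussian_moments.
Variable R : realType.
Local Notation mu := (@lebesgue_measure R).
Implicit Types (f g F : R -> R) (s v : R).

(** The integral over [[-n, n]] is [F n - F (- n)], which the decay of [F] sends to 0; dominated
    convergence passes to the whole line. This stands in for integration by parts in the moment
    computations. *)
Lemma integral_derivative_eq0 F f (C : R) :
  (forall x : R, is_derive x 1 F (f x)) -> continuous f ->
  mu.-integrable setT (EFin \o f) -> (forall x, `|x| * `|F x| <= C) ->
  \int[mu]_x f x = 0.
Proof.
move=> dF cf intf FC.
have C0 : 0 <= C by rewrite (le_trans _ (FC 0)) ?mulr_ge0.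
have mf : measurable_fun setT f by exact: continuous_measurable_fun.
have cF x : {for x, continuous F}.
  by apply/differentiable_continuous/derivable1_diffP; have [] := dF x.
pose f_ n := (EFin \o f) \_ `[- (n.+1%:R : R), n.+1%:R].
have intE n : (\int[mu]_x f_ n x = (F n.+1%:R - F (- n.+1%:R))%:E)%E.
  rewrite /f_ -integral_mkcond EFinB; apply: (@continuous_FTC2 R f F).
  - by rewrite -subr_gt0 opprK addr_gt0.
  - exact: continuous_subspaceT.
  - split; [by move=> x _; have [] := dF x|..].
      exact/cvg_at_right_filter/cF.
    exact/cvg_at_left_filter/cF.
  - by move=> x _; rewrite derive1E; have [] := dF x.
have [] := @dominated_convergence _ _ _ mu setT measurableT f_ (EFin \o f)
  (abse \o (EFin \o f)).
- move=> n; apply/(measurable_restrictT _ _).1 => //.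
  by apply/measurable_EFinP; exact: measurable_funTS.
- exact/measurable_EFinP.
- apply/aeW => x _; apply: cvg_near_cst.
  have [n _ nx] := @nbhs_infty_ger R `|x|.
  exists n => // m nm; rewrite /f_ patchE mem_set//= in_itv/= -ler_norml.
  by rewrite (le_trans (nx m nm))// ler_nat.
- exact: integrable_abse.
- apply/aeW => x n _; rewrite /f_ patchE; case: ifPn => // _.
  by rewrite abse0 abse_ge0.
move=> _ _ + ; rewrite /= => cvgI.
have cvg0 : (\int[mu]_x f_ n x)%E @[n --> \oo] --> (0 : \bar R)%E.
  under eq_fun do rewrite intE.
  apply: cvg_EFin; first by near=> n.
  rewrite /comp/=.
  (* [harmonic n] is [1 / (n + 1)], matching the truncation at [n + 1]. *)
  have FE (y : R) n : `|y| = n.+1%:R -> `|F y| <= C * harmonic n.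
    by move=> yn; rewrite -ler_pdivrMr ?invr_gt0// invrK mulrC -yn.
  apply: (@squeeze_cvgr _ _ _ _ (fun n => - (2 * C * harmonic n))
    (fun n => 2 * C * harmonic n)).
  - near=> n; rewrite -ler_norml (le_trans (ler_normB _ _))//.
    rewrite -mulrA mulr_natl mulr2n lerD// FE// ?normrN ger0_norm//.
  - rewrite -oppr0; apply: cvgN; rewrite -(mulr0 (2 * C)).
    by apply: cvgMr; exact: cvg_harmonic.
  - by rewrite -(mulr0 (2 * C)); apply: cvgMr; exact: cvg_harmonic.
by rewrite /Rintegral -(cvg_lim _ cvgI)// (cvg_lim _ cvg0).
Unshelve. all: by end_near. Qed.

(** With [z = x^2 / (8 s^2)] the two exponents are [- 4 z] and [- z]; the spare factor
    [expR z >= 1 + z] absorbs the polynomial. Integrability of a quadratic times a density thus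
    reduces to that of a wider density. *)
Lemma normal_pdf_moment_bound s : 0 < s -> exists2 C, 0 <= C &
  forall x, (1 + x ^+ 2) * normal_pdf 0 s x <= C * normal_pdf 0 (2 * s) x.
Proof.
move=> s0; have s20 : 0 < 2 * s by rewrite mulr_gt0.
exists ((1 + 8 * s ^+ 2) * normal_peak s / normal_peak (2 * s)).
  apply: divr_ge0 (normal_peak_ge0 _); apply: mulr_ge0 (normal_peak_ge0 _).
  by rewrite addr_ge0// mulr_ge0// sqr_ge0.
move=> x; rewrite !normal_pdfE ?gt_eqF//= [leRHS]mulrA.
rewrite mulfVK ?gt_eqF ?normal_peak_gt0 ?gt_eqF//.
rewrite mulrCA -(mulrC (normal_peak s)) -mulrA ler_wpM2l ?normal_peak_ge0//.
rewrite /normal_fun subr0.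
set z := x ^+ 2 / (8 * s ^+ 2).
have z0 : 0 <= z by rewrite divr_ge0 ?sqr_ge0// mulr_ge0// sqr_ge0.
have -> : - x ^+ 2 / (s ^+ 2 *+ 2) = - (4 * z).
  by rewrite /z; field; rewrite gt_eqF.
have -> : - x ^+ 2 / ((2 * s) ^+ 2 *+ 2) = - z.
  by rewrite /z; field; rewrite gt_eqF.
have -> : x ^+ 2 = 8 * s ^+ 2 * z by rewrite /z; field; rewrite gt_eqF.
have E1 : expR (- (4 * z)) * expR z <= expR (- z).
  by rewrite -expRD ler_expR; lra.
have E2 := @expR_ge1Dx R z.
apply: (@le_trans _ _ ((1 + 8 * s ^+ 2) * (expR (- (4 * z)) * expR z))).
  rewrite [leRHS]mulrCA [leLHS]mulrC ler_wpM2l ?expR_ge0//.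
  have := sqr_ge0 s; nra.
by rewrite ler_wpM2l// addr_ge0// mulr_ge0// sqr_ge0.
Qed.

Lemma is_derive_normal_pdf s (x : R) : s != 0 ->
  is_derive x 1 (normal_pdf 0 s) (- (x / s ^+ 2) * normal_pdf 0 s x).
Proof.
move=> s0; rewrite normal_pdfE//.
have d1 : is_derive x 1 (fun y : R => - (y - 0) ^+ 2 / (s ^+ 2 *+ 2)) (- (x / s ^+ 2)).
  have -> : (fun y : R => - (y - 0) ^+ 2 / (s ^+ 2 *+ 2)) =
      (fun y => (- (s ^+ 2 *+ 2)^-1) *: (y : R) ^+ 2).
    by apply/funext => y; rewrite /= subr0 mulNr mulrC -mulNr.
  apply: is_derive_eq; rewrite /GRing.scale/=; field => //.
have d2 := is_derive1_comp (is_derive_expR _) d1.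
have d3 := is_deriveZ (normal_peak s) d2.
apply: is_derive_eq d3 _.
by rewrite /GRing.scale/= /normal_fun; ring.
Qed.

Lemma integrable_normal_pdfM s f (C : R) : 0 < s -> measurable_fun setT f ->
  (forall x, `|f x| <= C * (1 + x ^+ 2)) ->
  mu.-integrable setT (EFin \o (fun x => normal_pdf 0 s x * f x)).
Proof.
move=> s0 mf fC; have [D D0 HD] := normal_pdf_moment_bound s s0.
have C0 : 0 <= C.
  by have := fC 0; rewrite expr0n addr0 mulr1; apply: le_trans.
have i := integrableZl measurableT (C * D) (integrable_normal_pdf 0 (2 * s)).
apply: le_integrable i => //.
- apply/measurable_EFinP/measurable_funM => //.
  exact: measurable_normal_pdf.
- move=> x _; rewrite /= lee_fin normrM ger0_norm ?normal_pdf_ge0//.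
  rewrite [leRHS]ger0_norm ?mulr_ge0 ?normal_pdf_ge0//.
  rewrite mulrC (le_trans (ler_wpM2r _ (fC x))) ?normal_pdf_ge0//.
  by rewrite -!mulrA ler_wpM2l.
Qed.


(** A class of integrands on which [gaussE v] is linear and monotone for every [v > 0], with no
    separate integrability conditions. *)
Definition quad_bounded f :=
  measurable_fun setT f /\ exists C, forall x, `|f x| <= C * (1 + x ^+ 2).

Lemma quad_bounded_integrable v f : 0 < v -> quad_bounded f ->
  mu.-integrable setT (EFin \o (fun x => normal_pdf 0 (Num.sqrt v) x * f x)).
Proof.
move=> v0 [mf [C fC]]; apply: integrable_normal_pdfM fC => //.
by rewrite sqrtr_gt0.
Qed.

Lemma quad_boundedD f g : quad_bounded f -> quad_bounded g ->
  quad_bounded (fun x => f x + g x).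
Proof.
move=> [mf [C fC]] [mg [D gD]]; split; first exact: measurable_funD.
by exists (C + D) => x; rewrite mulrDl (le_trans (ler_normD _ _))// lerD.
Qed.

Lemma quad_boundedZ c f : quad_bounded f -> quad_bounded (fun x => c * f x).
Proof.
move=> [mf [C fC]]; split; first exact: measurable_funM.
by exists (`|c| * C) => x; rewrite normrM -mulrA ler_wpM2l.
Qed.

Lemma quad_bounded_cst (c : R) : quad_bounded (fun=> c).
Proof.
split; first exact: measurable_cst.
by exists `|c| => x; rewrite ler_peMr// lerDl sqr_ge0.
Qed.

Lemma quad_bounded_id : quad_bounded id.
Proof.
split; first exact: measurable_id.
exists 1 => x; rewrite mul1r -(real_normK (num_real x)); have := sqr_ge0 (`|x| - 1); nra.
Qed.

Lemma quad_bounded_sqr : quad_bounded (fun x => x ^+ 2).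
Proof.
split; first exact: measurable_funX.
by exists 1 => x; rewrite mul1r ger0_norm ?sqr_ge0// lerDr.
Qed.

Lemma gaussED v f g : 0 < v -> quad_bounded f -> quad_bounded g ->
  gaussE v (fun x => f x + g x) = gaussE v f + gaussE v g.
Proof.
move=> v0 qf qg; rewrite /gaussE -RintegralD//; last 2 first.
  exact: quad_bounded_integrable.
  exact: quad_bounded_integrable.
by apply: eq_Rintegral => x _; rewrite mulrDr.
Qed.

Lemma gaussEZ v c f : 0 < v -> quad_bounded f ->
  gaussE v (fun x => c * f x) = c * gaussE v f.
Proof.
move=> v0 qf; rewrite /gaussE -RintegralZl//; last exact: quad_bounded_integrable.
by apply: eq_Rintegral => x _; rewrite mulrCA.
Qed.

Lemma le_gaussE v f g : 0 < v -> quad_bounded f -> quad_bounded g ->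
  (forall x, f x <= g x) -> gaussE v f <= gaussE v g.
Proof.
move=> v0 qf qg fg; apply: le_Rintegral => //; try exact: quad_bounded_integrable.
by move=> x _; rewrite ler_wpM2l ?normal_pdf_ge0.
Qed.

Lemma gaussE_cst v (c : R) : gaussE v (fun=> c) = c.
Proof.
rewrite /gaussE; under eq_Rintegral do rewrite mulrC.
rewrite RintegralZl//; last exact: integrable_normal_pdf.
by rewrite /Rintegral integral_normal_pdf mulr1.
Qed.

Lemma normal_pdf_quad_bound s : 0 < s ->
  exists C, forall x, (1 + x ^+ 2) * normal_pdf 0 s x <= C.
Proof.
move=> s0; have [D D0 HD] := normal_pdf_moment_bound s s0.
exists (D * normal_peak (2 * s)) => x; rewrite (le_trans (HD x))//.
by rewrite ler_wpM2l// normal_pdf_ub// mulf_neq0// gt_eqF.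
Qed.

(** The integrand is the derivative of [- s^2] times the density. *)
Lemma gaussE_id v : 0 < v -> gaussE v id = 0.
Proof.
move=> v0; set s := Num.sqrt v; have s0 : 0 < s by rewrite sqrtr_gt0.
have [C HC] := normal_pdf_quad_bound s s0.
apply: (@integral_derivative_eq0 (fun x => (- s ^+ 2) *: normal_pdf 0 s x)
  (fun x => normal_pdf 0 s x * x) (s ^+ 2 * C)).
- move=> x; have d := is_derive_normal_pdf s x (lt0r_neq0 s0).
  apply: (is_derive_eq (is_deriveZ (- s ^+ 2) d)).
  by rewrite /GRing.scale/=; field; rewrite gt_eqF.
- move=> x; apply: cvgM; last exact: cvg_id.
  by apply: continuous_normal_pdf; rewrite gt_eqF.
- exact/quad_bounded_integrable/quad_bounded_id.
- move=> x; rewrite normrM normrN (ger0_norm (sqr_ge0 _)) mulrCA.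
  rewrite ler_wpM2l ?sqr_ge0// (le_trans _ (HC x))// ger0_norm ?normal_pdf_ge0//.
  rewrite ler_wpM2r ?normal_pdf_ge0// -(real_normK (num_real x)).
  have := sqr_ge0 (`|x| - 1); nra.
Qed.

(** The density times [x^2 - v] is the derivative of [- v x] times the density. *)
Lemma gaussE_sqr v : 0 < v -> gaussE v (fun x => x ^+ 2) = v.
Proof.
move=> v0; set s := Num.sqrt v; have s0 : 0 < s by rewrite sqrtr_gt0.
have sE : s ^+ 2 = v by rewrite sqr_sqrtr// ltW.
have [C HC] := normal_pdf_quad_bound s s0.
have q : quad_bounded (fun x => x ^+ 2 + - v).
  exact: quad_boundedD quad_bounded_sqr (quad_bounded_cst _).
suff : gaussE v (fun x => x ^+ 2 + - v) = 0.
  rewrite gaussED//; [|exact: quad_bounded_sqr|exact: quad_bounded_cst].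
  by rewrite gaussE_cst => /eqP; rewrite subr_eq0 => /eqP.
apply: (@integral_derivative_eq0 (fun x => (- v) *: (x * normal_pdf 0 s x))
  (fun x => normal_pdf 0 s x * (x ^+ 2 + - v)) (v * C)).
- move=> x; have d := is_derive_normal_pdf s x (lt0r_neq0 s0).
  have d' := is_deriveM (is_derive_id x 1) d.
  apply: (is_derive_eq (is_deriveZ (- v) d')).
  by rewrite /GRing.scale/= -sE; field; rewrite gt_eqF.
- move=> x; apply: cvgM.
    by apply: continuous_normal_pdf; rewrite gt_eqF.
  by apply: cvgD; [exact: sqr_continuous|exact: cvg_cst].
- exact: quad_bounded_integrable.
- move=> x; rewrite normrM normrN (ger0_norm (ltW v0)) mulrCA.
  rewrite ler_wpM2l ?(ltW v0)// (le_trans _ (HC x))// normrM.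
  rewrite (ger0_norm (normal_pdf_ge0 _ _ _)) mulrA.
  by rewrite ler_wpM2r ?normal_pdf_ge0// -expr2 real_normK ?num_real// lerDr.
Qed.

(** The error is [a w - (1 - a) y]; its cross term vanishes since [w] is centred. *)
Lemma test_mseE v a : 0 < v -> test_mse v a = (1 - a) ^+ 2 * v + a ^+ 2.
Proof.
move=> v0; rewrite /test_mse.
have qid := quad_bounded_id; have qsq := quad_bounded_sqr.
have qc := quad_bounded_cst.
have inner y : gaussE 1 (fun w => (a * (y + w) - y) ^+ 2) =
    a ^+ 2 + (1 - a) ^+ 2 * y ^+ 2.
  have -> : (fun w => (a * (y + w) - y) ^+ 2) = (fun w : R =>
      a ^+ 2 * w ^+ 2 + ((- (2 * a * (1 - a) * y)) * id w + (1 - a) ^+ 2 * y ^+ 2)).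
    by apply/funext => w; rewrite /=; ring.
  have q2 := quad_boundedZ (a ^+ 2) _ qsq.
  have q1 := quad_boundedZ (- (2 * a * (1 - a) * y)) _ qid.
  have q3 := quad_boundedD _ _ q1 (qc ((1 - a) ^+ 2 * y ^+ 2)).
  rewrite (gaussED _ _ _ ltr01 q2 q3) (gaussED _ _ _ ltr01 q1 (qc _)).
  by rewrite gaussE_cst !gaussEZ// gaussE_sqr// gaussE_id// mulr1 mulr0 add0r.
under eq_fun do rewrite inner.
rewrite gaussED//; last exact: quad_boundedZ.
by rewrite gaussE_cst gaussEZ// gaussE_sqr// addrC.
Qed.

End gaussian_moments.

Arguments quad_bounded {R} f.

(** * Gaussian probabilities of intervals *)

Section gaussian_interval.
Variable R : realType.
Local Notation mu := (@lebesgue_measure R).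
Implicit Types a b c v : R.

Lemma quad_bounded_indic_itv a b : @quad_bounded R \1_`[a, b].
Proof.
split; first exact: measurable_indic.
exists 1 => x; rewrite indicE mul1r; case: (x \in _) => /=.
  by rewrite normr1 lerDl sqr_ge0.
by rewrite normr0 addr_ge0// sqr_ge0.
Qed.

Lemma Rintegral_indic_itv a b c : a <= b ->
  \int[mu]_x (c * \1_`[a, b] x) = c * (b - a).
Proof.
move=> ab; rewrite RintegralZl//; last exact: integrable_indic_itv.
congr (_ * _); rewrite /Rintegral integral_indic//= setIT.
by rewrite lebesgue_measure_itv/= lte_fin; case: ltgtP ab => // ->; rewrite subrr.
Qed.

Lemma gaussE_itv_ge v a b c : 0 < v -> a <= b ->
  (forall x, a <= x <= b -> c <= normal_pdf 0 (Num.sqrt v) x) ->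
  c * (b - a) <= gaussE v \1_`[a, b].
Proof.
move=> v0 ab cpdf; rewrite -Rintegral_indic_itv//; apply: le_Rintegral => //.
- exact: (integrableZl measurableT _ (integrable_indic_itv a b true false)).
- exact/quad_bounded_integrable/quad_bounded_indic_itv.
- move=> x _; rewrite indicE; case: (boolP (x \in _)) => [|_]; last by rewrite !mulr0.
  by rewrite inE/= in_itv/= !mulr1; exact: cpdf.
Qed.

Lemma gaussE_itv_le v a b : 0 < v -> a <= b ->
  gaussE v \1_`[a, b] <= normal_peak (Num.sqrt v) * (b - a).
Proof.
move=> v0 ab; rewrite -Rintegral_indic_itv//; apply: le_Rintegral => //.
- exact/quad_bounded_integrable/quad_bounded_indic_itv.
- exact: (integrableZl measurableT _ (integrable_indic_itv a b true false)).
- move=> x _; rewrite ler_wpM2r// normal_pdf_ub// gt_eqF// sqrtr_gt0//.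
Qed.

End gaussian_interval.

(** * Iterated expectations of Lipschitz functions of a sum of squares *)

Section iid_sum_of_squares.
Variable R : realType.
Implicit Types (f g : R -> R) (u v : R).

(** Sums of squares stay in the half-line, whereas [s / (s + t)] has a pole at [- t]. *)
Definition lip0 f := exists L, forall x y, 0 <= x -> 0 <= y ->
  `|f x - f y| <= L * `|x - y|.

Lemma lip0_cst (c : R) : lip0 (fun=> c).
Proof. by exists 0 => x y _ _; rewrite subrr normr0 mul0r. Qed.

Lemma lip0_id : lip0 id.
Proof. by exists 1 => x y _ _; rewrite mul1r. Qed.

Lemma lip0D f g : lip0 f -> lip0 g -> lip0 (fun u => f u + g u).
Proof.
move=> [L Lf] [M Mg]; exists (L + M) => x y x0 y0.
rewrite opprD addrACA mulrDl (le_trans (ler_normD _ _))//.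
by rewrite lerD ?Lf ?Mg.
Qed.

Lemma lip0Z (c : R) f : lip0 f -> lip0 (fun u => c * f u).
Proof.
move=> [L Lf]; exists (`|c| * L) => x y x0 y0.
by rewrite -mulrBr normrM -mulrA ler_wpM2l// Lf.
Qed.

Lemma lip0_norm f : lip0 f -> lip0 (fun u => `|f u|).
Proof.
move=> [L Lf]; exists L => x y x0 y0.
by rewrite (le_trans (ler_dist_dist _ _))// Lf.
Qed.

Lemma lip0_max0 f : lip0 f -> lip0 (fun u => Num.max 0 (f u)).
Proof.
move=> lf; have -> : (fun u => Num.max 0 (f u)) = (fun u => 2^-1 * (f u + `|f u|)).
  apply/funext => u; case: (leP 0 (f u)) => h.
    by rewrite ger0_norm//; field.
  by rewrite ltr0_norm// subrr mulr0.
exact/lip0Z/lip0D/lip0_norm.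
Qed.

Lemma lip0_quad_bounded f u : lip0 f -> 0 <= u ->
  quad_bounded (fun y => f (u + y ^+ 2)).
Proof.
move=> [L Lf] u0.
have L0 : 0 <= L.
  have := Lf 1 0 ler01 (lexx _); rewrite subr0 normr1 mulr1.
  exact: le_trans.
have Lf' y z : `|f (u + y ^+ 2) - f (u + z ^+ 2)| <= L * `|y ^+ 2 - z ^+ 2|.
  by rewrite (le_trans (Lf _ _ _ _)) ?addr_ge0 ?sqr_ge0// opprD addrACA subrr add0r.
split.
  apply: continuous_measurable_fun => y; apply/cvgrPdist_le => /= e e0.
  have /cvgrPdist_le/(_ (e / (L + 1))) H := @sqr_continuous R y.
  (* Dividing by [L + 1] covers the case [L = 0]. *)
  have L1 : 0 < L + 1 by rewrite ltr_wpDl.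
  near=> z; rewrite (le_trans (Lf' _ _))//.
  have : `|y ^+ 2 - z ^+ 2| <= e / (L + 1).
    by near: z; apply: H; rewrite divr_gt0.
  rewrite ler_pdivlMr//; have := normr_ge0 (y ^+ 2 - z ^+ 2); nra.
exists (`|f u| + L) => y.
have := Lf' y 0; rewrite expr0n addr0 subr0 (ger0_norm (sqr_ge0 y)) => h.
rewrite -(subrK (f u) (f (u + y ^+ 2))) (le_trans (ler_normD _ _))//.
have := normr_ge0 (f u); have := sqr_ge0 y; nra.
Unshelve. all: by end_near. Qed.

(** The offset [u] collects the squares already drawn, so that one integration maps the family to
    itself and inductions on [n] close. *)
Definition sumsqE n v f u : R :=
  iidE n v (fun ys => f (u + \sum_(y <- ys) y ^+ 2)).

Lemma sumsqE0 v f u : sumsqE 0 v f u = f u.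
Proof. by rewrite /sumsqE/= big_nil addr0. Qed.

Lemma sumsqES n v f u :
  sumsqE n.+1 v f u = gaussE v (fun y => sumsqE n v f (u + y ^+ 2)).
Proof.
rewrite /sumsqE/=; congr gaussE; apply/funext => y; congr iidE.
by apply/funext => ys; rewrite big_cons addrA.
Qed.

(** Averaging keeps the Lipschitz constant: moving the offset from [a] to [b] changes the integrand
    by at most [L |a - b|] at every point. *)
Lemma lip0_sumsqE n v f : 0 < v -> lip0 f -> lip0 (sumsqE n v f).
Proof.
move=> v0 lf; elim: n => [|n IHn].
  by have -> : sumsqE 0 v f = f by apply/funext => u; rewrite sumsqE0.
have [L HL] := IHn; exists L => x y x0 y0; rewrite !sumsqES.
have dir a b : 0 <= a -> 0 <= b -> gaussE v (fun z => sumsqE n v f (a + z ^+ 2)) <=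
    L * `|a - b| + gaussE v (fun z => sumsqE n v f (b + z ^+ 2)).
  move=> a0 b0; rewrite -{1}(gaussE_cst _ v (L * `|a - b|)) -gaussED//; last 2 first.
    exact: quad_bounded_cst.
    exact: lip0_quad_bounded.
  apply: le_gaussE => //; first exact: lip0_quad_bounded.
    by apply: quad_boundedD (quad_bounded_cst _ _) _; exact: lip0_quad_bounded.
  move=> z; rewrite -lerBlDr (le_trans (ler_norm _))//.
  rewrite (le_trans (HL _ _ _ _)) ?addr_ge0 ?sqr_ge0//.
  by rewrite opprD addrACA subrr addr0.
have := dir _ _ x0 y0; have := dir _ _ y0 x0; rewrite (distrC y x).
by rewrite ler_norml; lra.
Qed.

Lemma quad_bounded_sumsqE n v f u : 0 < v -> lip0 f -> 0 <= u ->
  quad_bounded (fun y => sumsqE n v f (u + y ^+ 2)).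
Proof. by move=> v0 lf u0; apply: lip0_quad_bounded => //; exact: lip0_sumsqE. Qed.

Lemma le_sumsqE n v f g u : 0 < v -> lip0 f -> lip0 g ->
  (forall w, 0 <= w -> f w <= g w) -> 0 <= u ->
  sumsqE n v f u <= sumsqE n v g u.
Proof.
move=> v0 lf lg fg; elim: n u => [|n IHn] u u0; first by rewrite !sumsqE0 fg.
rewrite !sumsqES; apply: le_gaussE => //; try exact: quad_bounded_sumsqE.
by move=> y; rewrite IHn// addr_ge0// sqr_ge0.
Qed.

Lemma sumsqED n v f g u : 0 < v -> lip0 f -> lip0 g -> 0 <= u ->
  sumsqE n v (fun w => f w + g w) u = sumsqE n v f u + sumsqE n v g u.
Proof.
move=> v0 lf lg; elim: n u => [|n IHn] u u0; first by rewrite !sumsqE0.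
rewrite !sumsqES -gaussED//; try exact: quad_bounded_sumsqE.
by congr gaussE; apply/funext => y; rewrite IHn// addr_ge0// sqr_ge0.
Qed.

Lemma sumsqEZ n v (c : R) f u : 0 < v -> lip0 f -> 0 <= u ->
  sumsqE n v (fun w => c * f w) u = c * sumsqE n v f u.
Proof.
move=> v0 lf; elim: n u => [|n IHn] u u0; first by rewrite !sumsqE0.
rewrite !sumsqES -gaussEZ//; try exact: quad_bounded_sumsqE.
by congr gaussE; apply/funext => y; rewrite IHn// addr_ge0// sqr_ge0.
Qed.

Lemma sumsqE_cst n v (c : R) u : sumsqE n v (fun=> c) u = c.
Proof.
elim: n u => [|n IHn] u; first by rewrite sumsqE0.
by rewrite sumsqES; under eq_fun do rewrite IHn; rewrite gaussE_cst.
Qed.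

Lemma sumsqE_id n v u : 0 < v -> sumsqE n v id u = u + n%:R * v.
Proof.
move=> v0; elim: n u => [|n IHn] u; first by rewrite sumsqE0 mul0r addr0.
rewrite sumsqES; under eq_fun do rewrite IHn addrAC.
rewrite gaussED//; [|exact: quad_bounded_cst|exact: quad_bounded_sqr].
by rewrite gaussE_cst gaussE_sqr// -natr1; ring.
Qed.

(** By independence all [n] samples lie in [[a, b]] with probability at least [p^n], and [f] is
    nonnegative off that event. *)
Lemma sumsqE_ge_itv n v f (a b c p : R) u : 0 < v -> 0 <= a -> 0 <= c -> 0 <= p ->
  lip0 f -> (forall w, 0 <= w -> 0 <= f w) -> p <= gaussE v \1_`[a, b] ->
  0 <= u ->
  (forall w, u + n%:R * a ^+ 2 <= w <= u + n%:R * b ^+ 2 -> c <= f w) ->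
  p ^+ n * c <= sumsqE n v f u.
Proof.
move=> v0 a0 c0 p0 lf f0 pP; elim: n u => [|n IHn] u u0 fc.
  by rewrite expr0 mul1r sumsqE0 fc// !mul0r addr0 lexx.
rewrite exprSr mulrAC sumsqES.
apply: (@le_trans _ _ (p ^+ n * c * gaussE v \1_`[a, b])).
  by rewrite ler_wpM2l// mulr_ge0// exprn_ge0.
rewrite -gaussEZ//; last exact: quad_bounded_indic_itv.
apply: le_gaussE => //.
- exact/quad_boundedZ/quad_bounded_indic_itv.
- exact: quad_bounded_sumsqE.
- move=> y; have uy0 : 0 <= u + y ^+ 2 by rewrite addr_ge0 ?sqr_ge0.
  rewrite indicE; case: (boolP (y \in _)) => [|_]; last first.
    by rewrite mulr0 -(sumsqE_cst n v 0 (u + y ^+ 2)) le_sumsqE//; exact: lip0_cst.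
  rewrite inE/= in_itv/= mulr1 => /andP[ay yb]; apply: IHn => // w /andP[w1 w2].
  have ya : a ^+ 2 <= y ^+ 2 by rewrite ler_sqr ?nnegrE// (le_trans a0).
  have by_ : y ^+ 2 <= b ^+ 2.
    by rewrite ler_sqr ?nnegrE// ?(le_trans a0)// (le_trans ay).
  apply: fc; rewrite -natr1 !mulrDl !mul1r; apply/andP; split; lra.
Qed.

(** Further squares only increase the argument of [f], so the remaining samples may be dropped. *)
Lemma sumsqE_le_nonincreasing n v f u : 0 < v -> lip0 f ->
  (forall w z, 0 <= w -> w <= z -> f z <= f w) -> 0 <= u ->
  sumsqE n v f u <= f u.
Proof.
move=> v0 lf df; elim: n u => [|n IHn] u u0; first by rewrite sumsqE0.
rewrite sumsqES -[leRHS](gaussE_cst _ v); apply: le_gaussE => //.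
- exact: quad_bounded_sumsqE.
- exact: quad_bounded_cst.
- move=> y; have y0 := sqr_ge0 y.
  by rewrite (le_trans (IHn _ _)) ?addr_ge0// df// lerDl.
Qed.

(** Only lists of length [n] are ever fed to the integrand, which lets the [size] in [mean_sq]
    become the constant [N]. *)
Lemma eq_iidE n v (F G : seq R -> R) :
  (forall ys, size ys = n -> F ys = G ys) -> iidE n v F = iidE n v G.
Proof.
elim: n F G => [|n IHn] F G FG /=; first exact: FG.
congr gaussE; apply/funext => y; apply: IHn => ys sys.
by apply: FG; rewrite /= sys.
Qed.

End iid_sum_of_squares.

Arguments lip0 {R} f.
Arguments sumsqE {R} n v f u.

(** * Pointwise inequalities for the conditional test error *)

Section pointwise_bounds.
Variable R : realType.
Implicit Types s t rho : R.

Definition lbce_loss rho t s : R :=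
  (1 - s / (s + t)) ^+ 2 * rho + (s / (s + t)) ^+ 2.

(** A Lipschitz minorant of the indicator of [s / rho \in [1/8, 5/8]]. *)
Definition tent rho s : R := Num.max 0 (1 - 4 * `|s / rho - 3 / 8|).

(** A Lipschitz majorant of the indicator of [s < rho^-2] on the half-line, zero from [2 rho^-2]
    on. *)
Definition ramp rho s : R := 2 * Num.max 0 (1 - s * rho ^+ 2 / 2).

(** First-order expansion at [t = 1] with a remainder uniform in [s]. The difference quotient splits
    into a part proportional to [rho], costing [rho (1 - t)], and a subtracted part, costing
    [4 (1 - t)]. *)
Lemma lbce_loss_gain rho s t : 0 < rho -> 0 <= s -> 2^-1 <= t <= 1 ->
  (1 - t) * (2 * (s * (rho - s) / (s + 1) ^+ 3) - (4 + rho) * (1 - t)) <=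
  lbce_loss rho 1 s - lbce_loss rho t s.
Proof.
move=> rho0 s0 /andP[t2 t1].
have t0 : 0 < t by rewrite (lt_le_trans _ t2)// invr_gt0.
have st0 : 0 < s + t by rewrite ltr_wpDl.
have s10 : 0 < s + 1 by rewrite ltr_wpDl.
have e0 : 0 <= 1 - t by rewrite subr_ge0.
pose d := (s + 1) ^+ 2 * (s + t) ^+ 2.
have d0 : 0 < d by rewrite mulr_gt0 ?exprn_gt0.
have -> : lbce_loss rho 1 s - lbce_loss rho t s = (1 - t) *
    (s * rho * (s + 2 * t + t * s) / d - s ^+ 2 * (2 * s + 1 + t) / d).
  by rewrite /lbce_loss /d; field; rewrite !gt_eqF.
rewrite ler_wpM2l//.
have A : 2 * (s * rho / (s + 1) ^+ 3) - rho * (1 - t) <=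
    s * rho * (s + 2 * t + t * s) / d.
  apply: (@le_trans _ _ (s * rho * (s + 2 * t + t * s) / (s + 1) ^+ 4)).
    rewrite -subr_ge0.
    have -> : s * rho * (s + 2 * t + t * s) / (s + 1) ^+ 4 -
      (2 * (s * rho / (s + 1) ^+ 3) - rho * (1 - t)) =
      rho * (1 - t) * (((s + 1) ^+ 4 - s * (s + 2)) / (s + 1) ^+ 4).
      by field; rewrite gt_eqF.
    rewrite mulr_ge0 ?(mulr_ge0 (ltW rho0))// divr_ge0 ?exprn_ge0 ?(ltW s10)//.
    rewrite (_ : _ - _ = (s + 1) ^+ 2 * (s ^+ 2 + 2 * s) + 1); last by ring.
    by rewrite addr_ge0// mulr_ge0 ?sqr_ge0// addr_ge0 ?sqr_ge0// mulr_ge0.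
  rewrite ler_wpM2l//.
    by rewrite mulr_ge0 ?(mulr_ge0 s0 (ltW rho0))//; nra.
  rewrite lef_pV2 ?posrE ?exprn_gt0// /d (exprD (s + 1) 2 2) ler_wpM2l ?sqr_ge0//.
  by rewrite ler_sqr ?nnegrE ?(ltW st0) ?(ltW s10)// lerD2l.
have B : s ^+ 2 * (2 * s + 1 + t) / d <=
    2 * (s ^+ 2 / (s + 1) ^+ 3) + 4 * (1 - t).
  (* Replacing [2 s + 1 + t] by [2 (s + 1)] cancels one factor of [d]. *)
  apply: (@le_trans _ _ (2 * s ^+ 2 / ((s + 1) * (s + t) ^+ 2))).
    rewrite -subr_ge0.
    have -> : 2 * s ^+ 2 / ((s + 1) * (s + t) ^+ 2) - s ^+ 2 * (2 * s + 1 + t) / d =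
      s ^+ 2 * (1 - t) / d by rewrite /d; field; rewrite !gt_eqF.
    by rewrite divr_ge0 ?(ltW d0)// mulr_ge0// sqr_ge0.
  rewrite -subr_ge0.
  have -> : 2 * (s ^+ 2 / (s + 1) ^+ 3) + 4 * (1 - t) -
      2 * s ^+ 2 / ((s + 1) * (s + t) ^+ 2) =
      2 * (1 - t) * ((2 * (s + 1) ^+ 3 * (s + t) ^+ 2 - s ^+ 2 * (2 * s + 1 + t)) /
      ((s + 1) ^+ 3 * (s + t) ^+ 2)) by field; rewrite !gt_eqF.
  apply: mulr_ge0; first by rewrite mulr_ge0.
  rewrite divr_ge0//; last by rewrite ltW// mulr_gt0 ?exprn_gt0.
  have h1 : s ^+ 2 <= (s + t) ^+ 2 by rewrite ler_sqr ?nnegrE ?(ltW st0)// lerDl ltW.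
  have h2 : 2 * s + 1 + t <= 2 * (s + 1) ^+ 3 by nra.
  have h3 : 0 <= 2 * s + 1 + t by lra.
  have h4 := sqr_ge0 s; nra.
have -> : s * (rho - s) / (s + 1) ^+ 3 =
  s * rho / (s + 1) ^+ 3 - s ^+ 2 / (s + 1) ^+ 3 by rewrite mulrBr mulrBl expr2.
lra.
Qed.

(* The difference of the two sides without [tent] and [ramp] is
   [(rho - s)^2 (s rho (rho + s) + 3 s rho - 1) / ((s + 1)^3 (rho + 1)^3)]:
   it is of order [1 / rho] where [tent] lives, and can be negative only for
   [s < rho^-2], where [ramp >= 1]. *)
Lemma marginal_gain_ge rho s : 2 <= rho -> 0 <= s ->
  rho / (rho + 1) ^+ 3 * (rho - s) + tent rho s / (64 ^+ 2 * rho) - ramp rho s / rho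
  <= s * (rho - s) / (s + 1) ^+ 3.
Proof.
move=> rho2 s0.
have rho0 : 0 < rho by lra.
have s10 : 0 < s + 1 by lra.
have r10 : 0 < rho + 1 by lra.
pose d := (s + 1) ^+ 3 * (rho + 1) ^+ 3.
have d0 : 0 < d by rewrite mulr_gt0 ?exprn_gt0.
pose q := (rho - s) ^+ 2 * (s * rho * (rho + s) + 3 * s * rho - 1) / d.
have -> : s * (rho - s) / (s + 1) ^+ 3 = rho / (rho + 1) ^+ 3 * (rho - s) + q.
  by rewrite /q /d; field; rewrite !gt_eqF.
rewrite -addrA lerD2l.
have srho : 0 <= s * rho by rewrite mulr_ge0 ?(ltW rho0).
have ramp0 : 0 <= ramp rho s / rho.
  by rewrite divr_ge0 ?(ltW rho0)// mulr_ge0// le_max lexx.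
have [tent_le0|tent_gt0] := leP (1 - 4 * `|s / rho - 3 / 8|) 0.
  rewrite {1}/tent max_l// mul0r add0r lerNl.
  have [big|small] := leP 1 (s * rho ^+ 2).
    apply: le_trans ramp0; rewrite oppr_le0 divr_ge0 ?(ltW d0)//.
    by rewrite mulr_ge0 ?sqr_ge0//; nra.
  have ramp1 : 1 <= ramp rho s by rewrite /ramp maxEle; case: ifP => h; lra.
  apply: (@le_trans _ _ rho^-1); last by rewrite ler_pdivlMr// mulVf// gt_eqF.
  (* Here [- q <= rho^2 / d <= 1 / rho], which [ramp >= 1] pays for. *)
  have ssmall : s <= rho by nra.
  rewrite /q -mulNr ler_pdivrMr// ler_pdivlMl//.
  have h1 : 0 <= (rho - s) ^+ 2 <= rho ^+ 2 by rewrite sqr_ge0/=; nra.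
  have h2 : rho ^+ 3 <= d.
    rewrite /d (le_trans (_ : _ <= (rho + 1) ^+ 3))//.
      by rewrite lerXn2r ?nnegrE ?(ltW rho0) ?(ltW r10)// lerDl.
    by rewrite ler_peMl ?exprn_ge0 ?(ltW r10)// exprn_ege1// lerDr.
  rewrite (le_trans _ h2)// -mulrN opprB exprS ler_wpM2l ?(ltW rho0)//.
  have k0 : 0 <= s * rho * (rho + s) + 3 * s * rho.
    by rewrite addr_ge0// ?mulr_ge0// ?addr_ge0// ?(ltW rho0)// mulr_ge0.
  have /andP[q0 q1] := h1; have := mulr_ge0 q0 k0; lra.
have tent1 : tent rho s <= 1.
  by rewrite /tent ge_max ler01/= lerBlDr lerDl mulr_ge0.
have [sl su] : rho / 8 <= s /\ s <= 5 * rho / 8.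
  have : `|s / rho - 3 / 8| < 4^-1 by lra.
  rewrite ltr_norml => /andP[h1 h2].
  have sE : s = s / rho * rho by rewrite divfK// gt_eqF.
  by split; rewrite sE; nra.
(* The numerator of [q] is at least [rho^5 / 64] and [d] at most [(2 rho)^6 = 64 rho^6], whence the
   constant [64^2]. *)
rewrite lerBlDr (le_trans (_ : _ <= (64 ^+ 2 * rho)^-1))//.
  by rewrite ler_piMl ?invr_ge0 ?mulr_ge0 ?(ltW rho0).
apply: ler_wpDr => //.
rewrite /q ler_pdivlMr// mulrC ler_pdivrMr ?mulr_gt0//.
have hd : d <= (2 * rho) ^+ 6.
  rewrite /d (exprD _ 3 3) ler_pM ?exprn_ge0 ?(ltW s10) ?(ltW r10)// lerXn2r//.
  - by rewrite nnegrE ltW.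
  - by rewrite nnegrE; lra.
  - lra.
  - by rewrite nnegrE ltW.
  - by rewrite nnegrE; lra.
  - lra.
rewrite (le_trans hd)//.
have h1 : rho ^+ 2 / 8 <= (rho - s) ^+ 2 by nra.
have h2 : rho ^+ 3 / 8 <= s * rho * (rho + s) + 3 * s * rho - 1.
  have : rho ^+ 3 / 8 <= s * rho * rho.
    rewrite (_ : _ / 8 = rho / 8 * rho * rho); [|by field].
    by rewrite !ler_wpM2r ?(ltW rho0).
  nra.
have h3 : rho ^+ 2 / 8 * (rho ^+ 3 / 8) <=
    (rho - s) ^+ 2 * (s * rho * (rho + s) + 3 * s * rho - 1).
  by rewrite ler_pM ?divr_ge0 ?exprn_ge0 ?(ltW rho0).
rewrite (_ : (2 * rho) ^+ 6 = rho ^+ 2 / 8 * (rho ^+ 3 / 8) * (64 ^+ 2 * rho)); last first.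
  by field.
by rewrite ler_wpM2r ?mulr_ge0 ?(ltW rho0).
Qed.

Lemma lip0_rescale (c : R) (f : R -> R) : 0 <= c -> lip0 f -> lip0 (fun u => f (u / c)).
Proof.
move=> c0 [L Lf]; exists (L / c) => x y x0 y0.
rewrite (le_trans (Lf _ _ _ _)) ?divr_ge0// -mulrBl normrM.
by rewrite (ger0_norm (_ : 0 <= c^-1)) ?invr_ge0// mulrCA mulrC mulrAC mulrC mulrA.
Qed.

(** The coefficient [s / (s + t)] lies in [[0, 1]] and is [1 / t]-Lipschitz; the loss is quadratic
    in it, with slope at most [2 rho + 2] there. *)
Lemma lip0_lbce_loss rho t : 0 < t -> 0 <= rho -> lip0 (lbce_loss rho t).
Proof.
move=> t0 rho0; exists ((2 * rho + 2) / t) => x y x0 y0.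
have xt : 0 < x + t by lra.
have yt : 0 < y + t by lra.
pose a := x / (x + t); pose b := y / (y + t).
have a01 : 0 <= a <= 1 by rewrite divr_ge0 ?(ltW xt)//= ler_pdivrMr// mul1r lerDl ltW.
have b01 : 0 <= b <= 1 by rewrite divr_ge0 ?(ltW yt)//= ler_pdivrMr// mul1r lerDl ltW.
have ab : `|a - b| <= t^-1 * `|x - y|.
  have -> : a - b = t / ((x + t) * (y + t)) * (x - y).
    by rewrite /a /b; field; rewrite !gt_eqF.
  rewrite normrM ler_wpM2r// ger0_norm; last first.
    by rewrite divr_ge0 ?mulr_ge0 ?(ltW t0) ?(ltW xt) ?(ltW yt).
  rewrite ler_pdivrMr ?mulr_gt0// ler_pdivlMl//.
  by rewrite ler_pM ?lerDr// ltW.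
have -> : lbce_loss rho t x - lbce_loss rho t y =
    (a + b - (2 - a - b) * rho) * (a - b) by rewrite /lbce_loss -/a -/b; ring.
rewrite normrM -mulrA ler_pM// ler_norml; nra.
Qed.

Lemma lip0_tent rho : lip0 (tent rho).
Proof.
apply: lip0_max0; apply: lip0D (lip0_cst _ _) _.
have -> : (fun s => - (4 * `|s / rho - 3 / 8|)) =
    (fun s : R => - 4 * `|rho^-1 * id s + - (3 / 8)|).
  by apply/funext => s; rewrite /= mulNr (mulrC s).
exact/lip0Z/lip0_norm/lip0D/lip0_cst/lip0Z/lip0_id.
Qed.

Lemma lip0_ramp rho : lip0 (ramp rho).
Proof.
apply/lip0Z/lip0_max0; apply: lip0D (lip0_cst _ _) _.
have -> : (fun s => - (s * rho ^+ 2 / 2)) = (fun s : R => - (rho ^+ 2 / 2) * id s).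
  by apply/funext => s /=; field.
exact/lip0Z/lip0_id.
Qed.

End pointwise_bounds.

(** * Expectations of [tent] and [ramp] at the empirical second moment *)

Section expectations.
Variables (R : realType) (N : nat).
Hypothesis N0 : (0 < N)%N.
Implicit Types rho lam : R.

Let NR0 : 0 < N%:R :> R. Proof. by rewrite ltr0n. Qed.

Lemma BMSE_sumsqE rho lam : 0 < rho ->
  BMSE N rho lam = sumsqE N rho (fun u => lbce_loss R rho (lam + 1)^-1 (u / N%:R)) 0.
Proof.
move=> rho0; apply: eq_iidE => ys sys.
by rewrite test_mseE// add0r /a_LBCE /mean_sq sys.
Qed.

Lemma normal_peak_sqrt rho : 0 < rho ->
  normal_peak (Num.sqrt rho) = normal_peak 1 / Num.sqrt rho.
Proof.
move=> rho0; rewrite /normal_peak sqr_sqrtr ?(ltW rho0)// expr1n mul1r -mulrnAr.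
by rewrite sqrtrM ?(ltW rho0)// invfM mulrC.
Qed.

Lemma normal_peak1_le1 : normal_peak (1 : R) <= 1.
Proof.
have pi1 : 1 <= (pi : R) *+ 2 by rewrite mulr2n; have := @pi_ge2 R; lra.
have sq1 : 1 <= Num.sqrt ((pi : R) *+ 2) by rewrite -[leLHS]sqrtr1 ler_wsqrtr.
by rewrite /normal_peak expr1n mul1r invf_le1// (lt_le_trans ltr01).
Qed.

(** The interval has length [s / 6] and the density there is at least half its peak, by
    [expR (- h) >= 1 - h]. The peak scales as [1 / s], so the bound does not depend on [rho]. *)
Lemma gaussE_central_itv_ge rho : 0 < rho ->
  normal_peak 1 / 12 <=
  gaussE rho \1_`[Num.sqrt rho / 2, Num.sqrt rho * (2 / 3)].
Proof.
move=> rho0; set s := Num.sqrt rho; have s0 : 0 < s by rewrite sqrtr_gt0.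
have -> : normal_peak 1 / 12 =
    normal_peak s / 2 * (s * (2 / 3) - s / 2) :> R.
  by rewrite normal_peak_sqrt// -/s; field; rewrite gt_eqF.
apply: gaussE_itv_ge => //; first lra.
move=> x /andP[x1 x2]; rewrite normal_pdfE ?gt_eqF//= ler_wpM2l ?normal_peak_ge0//.
rewrite /normal_fun subr0 (le_trans _ (expR_ge1Dx _))// mulNr.
have : x ^+ 2 / (s ^+ 2 *+ 2) <= 2^-1.
  by rewrite ler_pdivrMr ?mulrn_wgt0 ?exprn_gt0//; nra.
lra.
Qed.

(** Samples in the central interval put the mean square over [rho] in [[1/4, 4/9]], where
    [tent >= 1/2]. *)
Lemma tent_expectation_ge rho : 0 < rho ->
  (normal_peak 1 / 12) ^+ N / 2 <= sumsqE N rho (fun u => tent R rho (u / N%:R)) 0.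
Proof.
move=> rho0; set s := Num.sqrt rho; have s0 : 0 < s by rewrite sqrtr_gt0.
have sE : s ^+ 2 = rho by rewrite sqr_sqrtr// ltW.
apply: (@sumsqE_ge_itv _ _ _ _ (s / 2) (s * (2 / 3))) => //.
- by rewrite divr_ge0// ltW.
- by rewrite divr_ge0// normal_peak_ge0.
- apply: lip0_rescale; [exact: ltW|exact: lip0_tent].
- by move=> w _; rewrite /tent le_max lexx.
- exact: gaussE_central_itv_ge.
- move=> w; rewrite !add0r !exprMn sE => /andP[w1 w2].
  rewrite /tent le_max; apply/orP; right.
  have h1 : 4^-1 <= w / N%:R / rho by rewrite !ler_pdivlMr//; lra.
  have h2 : w / N%:R / rho <= 4 / 9 by rewrite !ler_pdivrMr//; lra.
  have : `|w / N%:R / rho - 3 / 8| <= 8^-1 by rewrite ler_norml; lra.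
  lra.
Qed.

(** A small mean square forces a small first sample. Only that sample is kept: the density is at
    most 1, the interval has length [4 N / rho], and [ramp <= 2]. *)
Lemma ramp_expectation_le rho : 1 <= rho ->
  sumsqE N rho (fun u => ramp R rho (u / N%:R)) 0 <= 8 * N%:R / rho.
Proof.
move=> rho1; have rho0 : 0 < rho by lra.
have N1 : 1 <= N%:R :> R by rewrite ler1n.
have lr : lip0 (fun u => ramp R rho (u / N%:R)).
  by apply: lip0_rescale; [exact: ltW|exact: lip0_ramp].
have dr w z : 0 <= w -> w <= z -> ramp R rho (z / N%:R) <= ramp R rho (w / N%:R).
  move=> w0 wz; rewrite /ramp ler_wpM2l// le_max2// lerD2l lerN2.
  by rewrite !ler_wpM2r ?invr_ge0 ?sqr_ge0// ltW.
case: {+}N N0 N1 lr dr => // n _ N1 lr dr; rewrite sumsqES.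
(* [ramp] vanishes once [y^2 >= 2 (n + 1) / rho^2]; [r^2] exceeds this, and [r] involves no square
   root. *)
pose r := 2 * n.+1%:R / rho.
have r0 : 0 <= r by rewrite divr_ge0 ?mulr_ge0 ?(ltW rho0).
apply: (@le_trans _ _ (gaussE rho (fun y => 2 * \1_`[- r, r] y))).
  apply: le_gaussE => //.
  - exact: quad_bounded_sumsqE.
  - exact/quad_boundedZ/quad_bounded_indic_itv.
  move=> y; rewrite add0r.
  rewrite (le_trans (sumsqE_le_nonincreasing _ _ _ _ _ _ _ _ _)) ?sqr_ge0//.
  rewrite /ramp ler_wpM2l// indicE; case: (boolP (y \in _)) => [_|].
    rewrite ge_max ler01/= lerBlDr lerDl divr_ge0// mulr_ge0 ?sqr_ge0//.
    by rewrite divr_ge0 ?sqr_ge0.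
  rewrite notin_setE/= in_itv/= -ler_norml => /negP; rewrite -ltNge => ry.
  have h : r ^+ 2 <= y ^+ 2.
    by rewrite -(real_normK (num_real y)) ler_sqr ?nnegrE// ltW.
  have rE : 2 * n.+1%:R = r * rho by rewrite divfK// gt_eqF.
  rewrite ge_max lexx/= subr_le0.
  rewrite (_ : _ / 2 = y ^+ 2 * rho ^+ 2 / (2 * n.+1%:R)); last first.
    by rewrite invfM; ring.
  rewrite ler_pdivlMr ?mulr_gt0// mul1r.
  apply: (@le_trans _ _ ((2 * n.+1%:R) ^+ 2)); first by rewrite ler_eXnr//; lra.
  by rewrite rE exprMn ler_wpM2r ?sqr_ge0.
rewrite gaussEZ//; last exact: quad_bounded_indic_itv.
have := gaussE_itv_le _ _ _ _ rho0 (_ : - r <= r).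
rewrite normal_peak_sqrt//.
have s1 : 1 <= Num.sqrt rho by rewrite -[leLHS]sqrtr1 ler_wsqrtr.
have p1 : normal_peak 1 / Num.sqrt rho <= 1.
  by rewrite ler_pdivrMr ?(lt_le_trans ltr01)// mul1r (le_trans normal_peak1_le1).
have -> : 8 * n.+1%:R / rho = 2 * (r + r) by rewrite /r; field; rewrite gt_eqF.
move=> /(_ ltac:(lra)); nra.
Qed.

End expectations.

Theorem theorem3 (R : realType) (N : nat) (hN : (0 < N)%N) :
  exists rho0 : R, forall rho : R, rho0 < rho ->
    exists lam : R, 0 < lam /\ BMSE N rho lam < BMSE N rho 0.
Proof.
pose P : R := (normal_peak 1 / 12) ^+ N.
have P0 : 0 < P by rewrite exprn_gt0// divr_gt0// normal_peak_gt0// oner_neq0.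
have NR0 : 0 < N%:R :> R by rewrite ltr0n.
(* [64^2] comes from the [tent] term of [marginal_gain_ge], 2 from the mean [P / 2] of [tent]. *)
pose K : R := 64 ^+ 2 * 2.
have K2 : 2 <= K by rewrite /K; lra.
(* The second bound says exactly that [kappa] below is positive. *)
exists (Num.max 2 (8 * N%:R * K / P)) => rho; rewrite gt_max => /andP[rho2 rhoK].
have rho0 : 0 < rho by lra.
have P1 : P <= 1.
  rewrite exprn_ile1 ?divr_ge0 ?normal_peak_ge0// ler_pdivrMr// mul1r.
  by rewrite (le_trans (normal_peak1_le1 R))// ler1n.
(* A lower bound for the mean of [s (rho - s) / (s + 1)^3], once the centred term has dropped
   out. *)
pose kappa := (P / K - 8 * N%:R / rho) / rho.
have kappa0 : 0 < kappa.
  rewrite divr_gt0// subr_gt0 ltr_pdivrMr// mulrAC ltr_pdivlMr; last lra.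
  by rewrite -ltr_pdivrMl// mulrC.
have kappa1 : kappa <= 1.
  rewrite ler_pdivrMr// mul1r lerBlDr (le_trans (_ : _ <= 1)) ?ler_pdivrMr//; try lra.
  by rewrite ler_wpDr ?divr_ge0 ?mulr_ge0 ?(ltW NR0) ?(ltW rho0)//; lra.
(* This maximises the guaranteed gain [eps (2 kappa - (4 + rho) eps)], giving [eps * kappa]. *)
pose eps := kappa / (4 + rho).
have eps0 : 0 < eps by rewrite divr_gt0//; lra.
have eps2 : eps <= 2^-1.
  by rewrite ler_pdivrMr; lra.
pose t := 1 - eps.
have t0 : 0 < t by rewrite /t; lra.
exists (t^-1 - 1); split.
  by rewrite subr_gt0 invf_gt1// /t; lra.
rewrite !BMSE_sumsqE// subrK invrK add0r invr1.
pose L tau u := lbce_loss R rho tau (u / N%:R).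
have lipL tau : 0 < tau -> lip0 (L tau).
  move=> tau0; apply: lip0_rescale (ltW NR0) _.
  by apply: lip0_lbce_loss => //; exact: ltW.
pose T u := tent R rho (u / N%:R).
pose Q u := ramp R rho (u / N%:R).
have lipT : lip0 T by apply: lip0_rescale (ltW NR0) _; exact: lip0_tent.
have lipQ : lip0 Q by apply: lip0_rescale (ltW NR0) _; exact: lip0_ramp.
pose g := rho / (rho + 1) ^+ 3.
(* A pointwise lower bound for the gain [L 1 - L t]. Its linear part has mean [- 2 eps g rho], as
   [u] has mean [N rho], and the constant cancels this. *)
pose low u := 2 * eps * (- g / N%:R) * id u + (2 * eps / (64 ^+ 2 * rho) * T u +
  ((- (2 * eps / rho)) * Q u + eps * (2 * g * rho - (4 + rho) * eps))).
have lip1 := lip0Z _ (2 * eps * (- g / N%:R)) _ (lip0_id R).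
have lip2 := lip0Z _ (2 * eps / (64 ^+ 2 * rho)) _ lipT.
have lip3 := lip0Z _ (- (2 * eps / rho)) _ lipQ.
have lip4 := lip0_cst _ (eps * (2 * g * rho - (4 + rho) * eps)).
have lip34 := lip0D _ _ _ lip3 lip4.
have lip234 := lip0D _ _ _ lip2 lip34.
have liplow : lip0 low by exact: lip0D.
have lowE : sumsqE N rho low 0 = 2 * eps / (64 ^+ 2 * rho) * sumsqE N rho T 0
    - 2 * eps / rho * sumsqE N rho Q 0 - eps * ((4 + rho) * eps).
  rewrite /low (sumsqED _ _ _ _ _ _ rho0 lip1 lip234 (lexx 0)).
  rewrite (sumsqED _ _ _ _ _ _ rho0 lip2 lip34 (lexx 0)).
  rewrite (sumsqED _ _ _ _ _ _ rho0 lip3 lip4 (lexx 0)).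
  rewrite (sumsqEZ _ _ _ _ _ _ rho0 (lip0_id R) (lexx 0)).
  rewrite (sumsqEZ _ _ _ _ _ _ rho0 lipT (lexx 0)).
  rewrite (sumsqEZ _ _ _ _ _ _ rho0 lipQ (lexx 0)).
  by rewrite sumsqE_id// sumsqE_cst; field; rewrite !gt_eqF.
have low0 : 0 < sumsqE N rho low 0.
  have Tge : P / 2 <= sumsqE N rho T 0 by exact: tent_expectation_ge.
  have Qle : sumsqE N rho Q 0 <= 8 * N%:R / rho.
    by apply: ramp_expectation_le => //; lra.
  (* The optimal gain plus the slacks of the [tent] and [ramp] bounds. *)
  have -> : sumsqE N rho low 0 = eps * (kappa + 2 / rho *
    ((sumsqE N rho T 0 - P / 2) / 64 ^+ 2 + (8 * N%:R / rho - sumsqE N rho Q 0))).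
    rewrite lowE /eps /kappa /K; field.
    by rewrite !gt_eqF//; lra.
  rewrite mulr_gt0// ltr_wpDr// mulr_ge0 ?divr_ge0 ?(ltW rho0)//.
  by rewrite addr_ge0 ?subr_ge0// divr_ge0 ?subr_ge0.
have key : sumsqE N rho (fun u => L t u + low u) 0 <= sumsqE N rho (L 1) 0.
  apply: le_sumsqE => //; [exact/lip0D/liplow/lipL|exact: lipL|].
  move=> u u0; have s0 : 0 <= u / N%:R by rewrite divr_ge0// ltW.
  rewrite addrC -lerBrDr.
  have t12 : 2^-1 <= t <= 1 by rewrite /t; lra.
  apply: le_trans (lbce_loss_gain _ _ _ _ rho0 s0 t12).
  have := marginal_gain_ge _ _ _ (ltW rho2) s0.
  rewrite -/(T u) -/(Q u) -/g /low (_ : 1 - t = eps); last by rewrite /t; lra.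
  set m := (X in _ <= X) => mge.
  rewrite [X in X <= _](_ : _ = eps * (2 * (g * (rho - u / N%:R) +
    T u / (64 ^+ 2 * rho) - Q u / rho) - (4 + rho) * eps)); last first.
    by field; rewrite !gt_eqF.
  by rewrite ler_wpM2l ?(ltW eps0)// lerD2r ler_wpM2l.
move: key; rewrite sumsqED//; [|exact: lipL]; rewrite -/(L t) -/(L 1).
lra.
Qed.
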